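(* Let $r \ge 2$, let $p \neq q$ be primes, and let $n \in \mathbb{N}$ with $n > 1$ and $\gcd(p,n) = 1 = \gcd(q,n)$. Set $M_1 = n \cdot p^\infty$, $M_2 = q^\infty$, $N_1 = p^\infty$, $N_2 = n \cdot q^\infty$. Then the actions $\gamma: \mathbb{F}_r \curvearrowright \partial\mathbb{F}_r \times (\mathbb{Z}/M_1) \times (\mathbb{Z}/M_2)$ and $\delta: \mathbb{F}_r \curvearrowright \partial\mathbb{F}_r \times (\mathbb{Z}/N_1) \times (\mathbb{Z}/N_2)$ defined in the context are continuously orbit equivalent but not conjugate.
   Context: Let $a_1,\dots,a_r$ be (free) generators of the free group $\mathbb{F}_r$, let $\beta: \mathbb{F}_r \curvearrowright \partial\mathbb{F}_r$ be the action on the Gromov boundary of $\mathbb{F}_r$ (infinite reduced words), and set $\beta_i = \beta_{a_i}$. A supernatural number is a formal product $M = \prod_l l^{v_l}$ over all primes $l$ with $v_l \in \{0,1,2,\dots\} \cup \{\infty\}$ and $\sum_l v_l = \infty$. Choose natural numbers $m_k$ with $v_l(m_k) \nearrow v_l(M)$ as $k \to \infty$ for all primes $l$ and set $\mathbb{Z}/M = \varprojlim_k \mathbb{Z}/m_k$. The canonical embedding $\mathbb{Z} \hookrightarrow \mathbb{Z}/M$ gives an action by translation, and $\alpha_M: \mathbb{Z}/M \to \mathbb{Z}/M$ denotes the homeomorphism given by the generator $1$ (the odometer transformation). The action $\gamma$ is determined on generators by $\gamma_{a_1} = \beta_1 \times \alpha_{M_1} \times \mathrm{id}$, $\gamma_{a_2}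 = \beta_2 \times \mathrm{id} \times \alpha_{M_2}$, $\gamma_{a_i} = \beta_i \times \mathrm{id} \times \mathrm{id}$ for $i \ge 3$. Similarly $\delta$ is determined by $\delta_{a_1} = \beta_1 \times \alpha_{N_1} \times \mathrm{id}$, $\delta_{a_2} = \beta_2 \times \mathrm{id} \times \alpha_{N_2}$, $\delta_{a_i} = \beta_i \times \mathrm{id} \times \mathrm{id}$ for $i \ge 3$. Systems $G \curvearrowright X$ and $H \curvearrowright Y$ are continuously orbit equivalent if there exist a homeomorphism $\varphi: X \to Y$ with inverse $\psi$ and continuous maps $a: G \times X \to H$, $b: H \times Y \to G$ (with $G$, $H$ discrete) such that $\varphi(g.x) = a(g,x).\varphi(x)$ and $\psi(h.y) = b(h,y).\psi(y)$ for all $g,x,h,y$. They are conjugate if there are a homeomorphism $\varphi: X \to Y$ and a group isomorphism $\rho: G \to H$ with $\varphi(g.x) = \rho(g).\varphi(x)$ for all $g,x$. *)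

(* Defs.v *)
From HB Require Import structures.
From mathcomp Require Import all_boot.
From mathcomp Require Import all_classical topology.

Set Implicit Arguments.
Unset Strict Implicit.
Unset Printing Implicit Defensive.

Local Open Scope classical_set_scope.
Local Open Scope nat_scope.

Record homeo (X Y : topologicalType) := Homeo {
  hfun :> X -> Y;
  hinv : Y -> X;
  hfunK : cancel hfun hinv;
  hinvK : cancel hinv hfun;
  hfun_cont : continuous hfun;
  hinv_cont : continuous hinv }.

Definition hid (X : topologicalType) : homeo X X.
Proof. by exists id id => // x; exact: cvg_id. Defined.

Lemma continuous_prod_map (X Y X' Y' : topologicalType)
    (f : X -> Y) (g : X' -> Y') :
  continuous f -> continuous g ->
  continuous (fun z : X * X' => (f z.1, g z.2)).
Proof.
move=> cf cg z; apply: cvg_pair.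
- by apply: (@continuous_comp _ _ _ fst f); [exact: cvg_fst|exact: cf].
- by apply: (@continuous_comp _ _ _ snd g); [exact: cvg_snd|exact: cg].
Qed.

Definition hprod (X Y X' Y' : topologicalType)
    (f : homeo X Y) (g : homeo X' Y') : homeo (X * X')%type (Y * Y')%type.
Proof.
exists (fun z => (f z.1, g z.2)) (fun z => (hinv f z.1, hinv g z.2)).
- by case=> x y /=; rewrite !hfunK.
- by case=> x y /=; rewrite !hinvK.
- exact: continuous_prod_map (@hfun_cont _ _ f) (@hfun_cont _ _ g).
- exact: continuous_prod_map (@hinv_cont _ _ f) (@hinv_cont _ _ g).
Defined.

Record top_action (G : groupType) (X : topologicalType) := TopAction {
  act :> G -> X -> X;
  act1 : forall x, act 1%g x = x;
  actM : forall g h x, act (g * h)%g x = act g (act h x);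
  act_cont : forall g, continuous (act g) }.

Definition act_homeo (G : groupType) (X : topologicalType)
    (A : top_action G X) (g : G) : homeo X X.
Proof.
exists (A g) (A g^-1%g).
- by move=> x; rewrite -actM mulVg act1.
- by move=> x; rewrite -actM mulgV act1.
- exact: act_cont.
- exact: act_cont.
Defined.

Definition cont_orbit_equiv (G H : groupType) (X Y : topologicalType)
    (A : top_action G X) (B : top_action H Y) : Prop :=
  exists (phi : homeo X Y)
         (a : discrete_topology G * X -> discrete_topology H)
         (b : discrete_topology H * Y -> discrete_topology G),
    [/\ continuous a,
        continuous b,
        (forall (g : G) x, phi (A g x) = B (a (g, x)) (phi x)) &
        (forall (h : H) y, hinv phi (B h y) = A (b (h, y)) (hinv phi y))].

Definition conjugate_actions (G H : groupType) (X Y : topologicalType)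
    (A : top_action G X) (B : top_action H Y) : Prop :=
  exists (phi : homeo X Y) (rho : {multiplicative G -> H}),
    bijective rho /\ forall g x, phi (A g x) = B (rho g) (phi x).

(* [(i, true)] stands for the generator of index [i], [(i, false)] for its
   inverse. *)
Notation letter r := ('I_r * bool)%type.

Definition linv r (x : letter r) : letter r := (x.1, ~~ x.2).

Lemma linvK r : involutive (@linv r).
Proof. by case=> i b; rewrite /linv /= negbK. Qed.

Definition reduced r (w : seq (letter r)) : bool :=
  sorted (fun x y => y != linv x) w.

(* The reduced form of [x w], for [w] reduced. *)
Definition lcons r (x : letter r) (w : seq (letter r)) : seq (letter r) :=
  if w is y :: w' then if y == linv x then w' else x :: w else [:: x].

Lemma reduced_lcons r (x : letter r) w : reduced w -> reduced (lcons x w).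
Proof.
case: w => [|y w] //= pw; case: eqP => [_|/eqP ne] /=; last by rewrite ne.
exact: path_sorted pw.
Qed.

Lemma lconsK r (x : letter r) w : reduced w -> lcons (linv x) (lcons x w) = w.
Proof.
case: w => [|y w] /=; first by rewrite linvK eqxx.
case: eqP => [->|_] /=; last by rewrite linvK eqxx.
by case: w => [|z w] //= /andP[/negbTE -> _].
Qed.

Lemma lconsVK r (x : letter r) w : reduced w -> lcons x (lcons (linv x) w) = w.
Proof. by move=> rw; rewrite -{1}[x]linvK lconsK. Qed.

(* The free group of rank [r], as reduced words. *)
Definition free_group (r : nat) : Type := {w : seq (letter r) | reduced w}.
HB.instance Definition _ r :=
  Choice.copy (free_group r) {w : seq (letter r) | reduced w}.

Section FreeGroup.
Variable r : nat.
Implicit Types (u v w : seq (letter r)) (g h : free_group r).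

Lemma reduced_mul u v : reduced v -> reduced (foldr (@lcons r) v u).
Proof. by move=> rv; elim: u => //= x u; exact: reduced_lcons. Qed.

(* A family of maps in which [f (linv x)] undoes [f x] turns [lcons] into
   composition. *)
Lemma foldr_lcons (T : Type) (P : T -> Prop) (f : letter r -> T -> T) t :
    (forall x s, P s -> P (f x s)) ->
    (forall x s, P s -> f x (f (linv x) s) = s) -> P t ->
  forall x w, foldr f t (lcons x w) = f x (foldr f t w).
Proof.
move=> fP fK Pt x [|y w] //=; case: eqP => [->|//].
by rewrite fK //; elim: w => //= z w; exact: fP.
Qed.

Definition fg_one : free_group r := exist (fun w => is_true (reduced w)) [::] isT.

Definition fg_mul g h : free_group r :=
  exist (fun w => is_true (reduced w)) (foldr (@lcons r) (val h) (val g))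
    (reduced_mul (val g) (valP h)).

Lemma reduced_inv w : reduced w -> reduced (rev (map (@linv r) w)).
Proof.
rewrite /reduced rev_sorted sorted_map; apply: sub_sorted => x y /=.
by rewrite linvK eq_sym.
Qed.

Definition fg_inv g : free_group r :=
  exist (fun w => is_true (reduced w)) (rev (map (@linv r) (val g)))
    (reduced_inv (valP g)).

Lemma fg_mulA : associative fg_mul.
Proof.
move=> g h k; apply: val_inj => /=; elim: (val g) => //= x u ->.
rewrite (@foldr_lcons _ (fun w => is_true (reduced w))) //.
- by move=> y s; exact: reduced_lcons.
- by move=> y s; exact: lconsVK.
- exact: (valP k).
Qed.

Lemma fg_mul1 : left_id fg_one fg_mul.
Proof. by move=> g; apply: val_inj. Qed.

Lemma fg_mulr1 : right_id fg_one fg_mul.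
Proof.
move=> [w rw]; apply: val_inj => /=; elim: w rw => //= x w IH pw.
rewrite IH; last exact: path_sorted pw.
by case: w pw {IH} => //= y w /andP[/negbTE -> _].
Qed.

Lemma fg_mulVg : left_inverse fg_one fg_inv fg_mul.
Proof.
move=> [w rw]; apply: val_inj => /=; elim: w {rw} => //= x w IH.
by rewrite rev_cons foldr_rcons /= linvK eqxx.
Qed.

Lemma fg_mulgV : right_inverse fg_one fg_inv fg_mul.
Proof.
have invK : involutive fg_inv.
  move=> [w rw]; apply: val_inj => /=.
  by rewrite map_rev revK mapK //; exact: linvK.
by move=> g; rewrite -{1}[g]invK fg_mulVg.
Qed.

HB.instance Definition _ := isGroup.Build (free_group r)
  fg_mulA fg_mul1 fg_mulr1 fg_mulVg fg_mulgV.

Definition gen (i : 'I_r) : free_group r :=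
  exist (fun w => is_true (reduced w)) [:: (i, true)] isT.

Section FreeAction.
Variables (X : topologicalType) (f : 'I_r -> homeo X X).

Definition letter_act (x : letter r) : X -> X :=
  if x.2 then hfun (f x.1) else hinv (f x.1).

Lemma letter_actK x t : letter_act x (letter_act (linv x) t) = t.
Proof. by case: x => i []; rewrite /letter_act /= ?hfunK ?hinvK. Qed.

Lemma letter_act_cont x : continuous (letter_act x).
Proof.
by case: x => i []; rewrite /letter_act /=; [exact: hfun_cont|exact: hinv_cont].
Qed.

Definition free_action : top_action (free_group r) X.
Proof.
exists (fun g x => foldr letter_act x (val g)) => //.
- move=> g h x /=; elim: (val g) => //= y u <-.
  by rewrite (@foldr_lcons _ (fun=> True)) // => z s _; exact: letter_actK.
- move=> g; elim: (val g) => [|y u IH] x /=; first exact: cvg_id.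
  apply: (@continuous_comp _ _ _ (fun t => foldr letter_act t u)
    (letter_act y)); [exact: IH|exact: letter_act_cont].
Defined.

Lemma free_action_gen i x : free_action (gen i) x = f i x.
Proof. by []. Qed.

Lemma free_action_unique (A : top_action (free_group r) X) :
  (forall i x, A (gen i) x = f i x) -> forall g x, A g x = free_action g x.
Proof.
move=> Af [w rw] x /=; elim: w rw => [|y w IH] rw.
  by rewrite -[RHS](act1 A); congr (act A _ x); apply: val_inj.
have rw' : reduced w by exact: path_sorted rw.
pose gy : free_group r := exist (fun w => is_true (reduced w)) [:: y] isT.
rewrite /= -(IH rw').
have -> : exist _ (y :: w) rw = (gy * exist _ w rw')%g :> free_group r.
  apply: val_inj => /=; case: w rw {IH rw'} => //= z w /andP[/negbTE -> _] //.
rewrite actM; case: y @gy {rw} => i [] /=; rewrite /letter_act /=.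
  by rewrite -Af; congr (act A _ _); apply: val_inj.
apply: (can_inj (hfunK (f i))); rewrite hinvK -Af -actM -[RHS](act1 A).
by congr (act A _ _); apply: val_inj; rewrite /= eqxx.
Qed.

End FreeAction.
End FreeGroup.

Section ProductOfDiscrete.
Variables (T : nat -> choiceType).
Let P := prod_topology (fun k => discrete_topology (T k)).
Variable (A : set P).

Lemma near_coord (x : A) n : \forall y \near x, val y n = val x n.
Proof.
have c : {for x, continuous (@proj _ _ n \o set_val : A -> discrete_topology (T n))}.
  apply: (@continuous_comp A P (discrete_topology (T n)) set_val).
    exact: initial_continuous.
  exact: proj_continuous.
have /c : nbhs (set_val x n : discrete_topology (T n)) [set set_val x n].
  exact: discrete_set1.
by rewrite /= set_valE.
Qed.

Lemma continuous_coord (Y : topologicalType) (f : Y -> A) :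
  (forall n x, \forall y \near x, val (f y) n = val (f x) n) -> continuous f.
Proof.
move=> fn; apply: continuous_comp_initial => /= x; apply/cvg_sup => n U.
move=> [V [[W oW <-] /= Wx WU]].
by apply: filterS (fn n x) => y e; apply: WU; rewrite /= [_ n]e.
Qed.

End ProductOfDiscrete.

(* The Gromov boundary: infinite reduced words. *)
Definition boundary_set (r : nat) :
    set (prod_topology (fun _ : nat => discrete_topology (letter r))) :=
  [set w | forall n, w n.+1 != linv (w n)].

Definition boundary (r : nat) : topologicalType := set_type (@boundary_set r).

Section Boundary.
Variable r : nat.

Definition bcons_fun (x : letter r) (w : nat -> letter r) : nat -> letter r :=
  if w 0 == linv x then fun n => w n.+1
  else fun n => if n is n'.+1 then w n' else x.

Lemma bcons_subproof (x : letter r) (w : boundary r) :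
  bcons_fun x (val w) \in @boundary_set r.
Proof.
apply/mem_set => n; case: w => w /= /set_mem rw; rewrite /bcons_fun.
by case: ifPn => [_|ne]; [exact: rw|case: n => [|n] //; exact: rw].
Qed.

(* The reduced form of the infinite word [x w]. *)
Definition bcons (x : letter r) (w : boundary r) : boundary r :=
  exist _ (bcons_fun x (val w)) (bcons_subproof x w).

Lemma bconsK x : cancel (bcons x) (bcons (linv x)).
Proof.
case=> w rw; apply: val_inj => /=; have {rw} := set_mem rw => rw.
apply: funext => n; rewrite /bcons_fun; case: (eqVneq (w 0) (linv x)) => e /=.
  by rewrite linvK -[x in _ == x]linvK -e (negbTE (rw 0)); case: n.
by rewrite linvK eqxx.
Qed.

Lemma bcons_cont x : continuous (bcons x).
Proof.
apply: continuous_coord => n w.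
near=> v => /=; rewrite /bcons_fun.
have -> : val v 0 = val w 0 by near: v; exact: near_coord.
have en : val v n.+1 = val w n.+1 by near: v; exact: near_coord.
have en' : val v n.-1 = val w n.-1 by near: v; exact: near_coord.
by case: ifP => // _; move: en'; case: (n).
Unshelve. all: by end_near. Qed.

Definition boundary_gen (i : 'I_r) : homeo (boundary r) (boundary r) :=
  @Homeo _ _ (bcons (i, true)) (bcons (i, false))
    (@bconsK (i, true)) (@bconsK (i, false))
    (@bcons_cont (i, true)) (@bcons_cont (i, false)).

Definition boundary_action : top_action (free_group r) (boundary r) :=
  free_action boundary_gen.

End Boundary.

(* [vexp l] is the exponent of the prime [l], [None] standing for infinity;
   values at non-primes are irrelevant. [vexp_infty] says that the exponents
   have infinite sum; replacing infinite exponents by [B] does not affect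
   whether partial sums reach [B]. *)
Record supernatural := Supernatural {
  vexp :> nat -> option nat;
  vexp_infty : forall B : nat, exists N : nat,
    B <= \sum_(0 <= l < N | prime l) odflt B (vexp l) }.

Definition prime_infty (p : nat) (hp : prime p) : supernatural.
Proof.
exists (fun l => if l == p then None else Some 0) => B; exists p.+1.
by rewrite big_mkcond big_nat_recr //= hp eqxx leq_addl.
Defined.

(* Meant for [0 < n]. *)
Definition smul (n : nat) (M : supernatural) : supernatural.
Proof.
exists (fun l => omap (addn (logn l n)) (M l)) => B.
have [N hN] := vexp_infty M B; exists N; apply: leq_trans hN _.
by apply: leq_sum => l _; case: (M l) => //= e; exact: leq_addl.
Defined.

(* A choice of natural numbers [m_k] with [v_l(m_k)] increasing to [v_l(M)]. *)
Record presentation (M : supernatural) := Presentation {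
  pseq :> nat -> nat;
  pseq_gt0 : forall k, 0 < pseq k;
  pseq_nd : forall l, prime l -> forall k,
    logn l (pseq k) <= logn l (pseq k.+1);
  pseq_cvg : forall l, prime l ->
    if M l is Some e then logn l (pseq k) @[k --> \oo] --> e
    else logn l (pseq k) @[k --> \oo] --> \oo }.

Lemma pseq_dvd M (m : presentation M) k : m k %| m k.+1.
Proof.
apply/dvdn_partP => [|l]; first exact: pseq_gt0.
move=> /[!mem_primes] /andP[pl _].
by rewrite p_part pfactor_dvdn ?pseq_gt0 // pseq_nd.
Qed.

Lemma logn_prod_primes (e : nat -> nat) N l : prime l ->
  logn l (\prod_(0 <= i < N | prime i) i ^ e i) = if l < N then e l else 0.
Proof.
move=> pl; elim: N => [|N IH]; first by rewrite big_nil logn1.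
have gt0 : 0 < \prod_(0 <= i < N | prime i) i ^ e i.
  by apply: prodn_cond_gt0 => i /prime_gt0 i0; rewrite expn_gt0 i0.
rewrite big_mkcond big_nat_recr //= -big_mkcond /=.
case: (boolP (prime N)) => pN; last first.
  rewrite /= muln1 IH ltnS [l <= N]leq_eqVlt; case: (eqVneq l N) => [lN|_ //].
  by rewrite -lN pl in pN.
rewrite /= lognM //; last by rewrite expn_gt0 prime_gt0.
rewrite IH lognX logn_prime // ltnS [l <= N]leq_eqVlt.
by case: (eqVneq l N) => [->|_] /=; rewrite ?ltnn ?muln1 // muln0 addn0.
Qed.

Lemma presentation_exists M : inhabited (presentation M).
Proof.
pose e k l := if M l is Some a then a else k.
pose m k := \prod_(0 <= l < k | prime l) l ^ e k l.
have lm l k : prime l -> logn l (m k) = if l < k then e k l else 0.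
  exact: logn_prod_primes.
split; exists m.
- by move=> k; apply: prodn_cond_gt0 => i /prime_gt0 i0; rewrite expn_gt0 i0.
- move=> l pl k; rewrite !lm //; case: ltnP => // lk.
  by rewrite (ltn_trans lk) // /e; case: (M l).
- move=> l pl; case E: (M l) => [a|].
    apply: cvg_near_cst; exists l.+1 => // k /= lk.
    by rewrite lm // lk /e E.
  move=> A [N _ NA]; exists (maxn l.+1 N) => // k /=.
  rewrite geq_max => /andP[lk Nk]; apply: NA.
  by rewrite /= lm // lk /e E.
Qed.

Section Odometer.
Variables (M : supernatural) (m : presentation M).

(* [Z/M], the inverse limit of the discrete groups [Z/m_k]. *)
Definition Zmod_set :
    set (prod_topology (fun k : nat => discrete_topology 'I_(m k))) :=
  [set x | forall k, nat_of_ord (x k.+1) %% m k = nat_of_ord (x k)].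

Definition Zmod : topologicalType := set_type Zmod_set.

Lemma odo_subproof (x : Zmod) :
  (fun k => ordS (val x k)) \in Zmod_set.
Proof.
apply/mem_set => k; case: x => x /= /set_mem cx.
by rewrite modn_dvdm ?pseq_dvd // -addn1 -modnDml cx addn1.
Qed.

Lemma odo_inv_subproof (x : Zmod) :
  (fun k => ord_pred (val x k)) \in Zmod_set.
Proof.
apply/mem_set => k; case: x => x /= /set_mem cx.
have m0 : 0 < m k by exact: pseq_gt0.
pose z := Ordinal (ltn_pmod (ord_pred (x k.+1)) m0).
suff e : x k = ordS z.
  by rewrite -[RHS]/(nat_of_ord (ord_pred (x k))) e ordSK.
apply: val_inj; rewrite /= -[in LHS]cx -[x k.+1 in LHS]ord_predK /=.
by rewrite modn_dvdm ?pseq_dvd // -[in RHS]addn1 modnDml addn1.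
Qed.

Definition odo (x : Zmod) : Zmod :=
  exist (fun y => is_true (y \in Zmod_set)) (fun k => ordS (val x k))
    (odo_subproof x).
Definition odo_inv (x : Zmod) : Zmod :=
  exist (fun y => is_true (y \in Zmod_set)) (fun k => ord_pred (val x k))
    (odo_inv_subproof x).

(* Translation by [1]: [ordS] is addition of [1] in [Z/m_k]. *)
Definition odometer : homeo Zmod Zmod.
Proof.
exists odo odo_inv.
- by move=> x; apply: val_inj; apply: functional_extensionality_dep => k /=;
    rewrite ordSK.
- by move=> x; apply: val_inj; apply: functional_extensionality_dep => k /=;
    rewrite ord_predK.
- apply: continuous_coord => k x; near=> y => /=.
  by congr ordS; near: y; exact: near_coord.
- apply: continuous_coord => k x; near=> y => /=.
  by congr ord_pred; near: y; exact: near_coord.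
Unshelve. all: by end_near.
Defined.

End Odometer.

Section OdometerAction.
Variables (r : nat) (M1 M2 : supernatural).
Variables (m1 : presentation M1) (m2 : presentation M2).

Definition odo_space : topologicalType :=
  (boundary r * Zmod m1 * Zmod m2)%type.

(* Indices start at [0]: the generators a_1, a_2 have indices 0 and 1. *)
Definition odo_gen (i : 'I_r) : homeo odo_space odo_space :=
  let beta_i := act_homeo (boundary_action r) (gen i) in
  match val i with
  | 0 => hprod (hprod beta_i (odometer m1)) (hid _)
  | 1 => hprod (hprod beta_i (hid _)) (odometer m2)
  | _ => hprod (hprod beta_i (hid _)) (hid _)
  end.

Definition odo_action : top_action (free_group r) odo_space :=
  free_action odo_gen.

End OdometerAction.

(* Main.v *)
(** Orbit equivalence. Write an element of [Z/(n P)] as [i + n u] with [i < n]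
    and [u] in [Z/P]. Restricting [gamma] to [i = 0] gives the action of the
    subgroup H1 of words whose exponent sum of [a_1] is divisible by [n], and
    similarly H2 for [delta] and [a_2]. The free groups H1 and H2 are isomorphic
    by a map that takes the exponent sum of [a_1] divided by [n] to that of
    [a_1], and that of [a_2] to that of [a_2] divided by [n]. The isomorphism
    extends to a cocycle [F_r x Z/n -> F_r], whose sections are bi-Lipschitz
    bijections of the tree and so induce homeomorphisms [theta_i] of the
    boundary. The equivalence is
    [(w, i + n u, v) |-> (theta_i w, u, i + n v)].

    Non-conjugacy. Let [rho] be the automorphism of a conjugacy and [e] the
    exponent sum of [a_1] composed with the inverse of [rho]. The first odometer
    coordinate of [gamma], transported to the second system, is continuous and
    is shifted by [e g] under [g]. Over the fixed point [a_j^oo] of the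
    boundary, powers of [a_j] with exponent [L] return close to the starting
    point when [L] is a modulus of the odometer that [a_j] moves, so that
    [L * e a_j] is small in [Z/M_1]. For [j <> 2] the numbers [L] are powers of
    [p], hence [n] divides [e a_j]; for [j = 2] they are prime to [p], hence
    [e a_2 = 0]. Then [n] divides all values of [e], although [e] takes the
    value [1]. *)

Require Import Defs.
From mathcomp Require Import all_boot all_algebra zify ring.
From mathcomp Require Import all_classical topology.

Set Implicit Arguments.
Unset Strict Implicit.
Unset Printing Implicit Defensive.
Import GRing.Theory.

(** * Reduced words and cancellation *)

Lemma reduced_catl r (u v : seq (letter r)) : reduced (u ++ v) -> reduced u.
Proof.
by rewrite /reduced; case: u => //= s u; rewrite cat_path => /andP[].
Qed.

Lemma foldr_lcons_cat r (u v : seq (letter r)) :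
  reduced (u ++ v) -> foldr (@lcons r) v u = u ++ v.
Proof.
elim: u => //= s u IH suv; rewrite IH; last exact: path_sorted suv.
by case: (u ++ v) suv => //= t w /andP[/negbTE ->].
Qed.

Lemma size_lcons r s (w : seq (letter r)) : size (lcons s w) <= (size w).+1.
Proof. by case: w => //= t w; case: ifP => //= _; rewrite leqW. Qed.

Lemma size_mulw r (u v : seq (letter r)) :
  size (foldr (@lcons r) v u) <= size u + size v.
Proof. by elim: u => //= s u IH; apply: leq_trans (size_lcons _ _) _. Qed.

Lemma size_fg_mul r (g h : free_group r) :
  size (val (g * h)%g) <= size (val g) + size (val h).
Proof. exact: size_mulw. Qed.

Definition fg_letter r (s : letter r) : free_group r :=
  exist (fun w => is_true (reduced w)) [:: s] isT.

Definition fg_word r (w : seq (letter r)) : free_group r :=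
  foldr (fun s g => fg_letter s * g)%g 1%g w.

Lemma fg_word_val r (g : free_group r) : fg_word (val g) = g.
Proof.
apply: val_inj; rewrite -[in RHS](mulg1 g) /=.
by elim: (val g) => //= s w <-.
Qed.

Lemma mulg_letterr r (g : free_group r) (s : letter r) :
  val (g * fg_letter s)%g = rcons (val g) s \/
  val g = rcons (val (g * fg_letter s)%g) (linv s).
Proof.
case: g => g /=; case/lastP: g => [|g t] rg /=; first by left.
rewrite foldr_rcons /=; case: (eqVneq s (linv t)) => [->|st].
  right; rewrite linvK foldr_lcons_cat cats0 //.
  by move: rg; rewrite -cats1 => /reduced_catl.
left; have -> : rcons (rcons g t) s = g ++ [:: t; s].
  by rewrite -!cats1 -catA.
rewrite foldr_lcons_cat //; move: rg; rewrite /reduced.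
case: g => [|u g] /=; first by rewrite st.
by rewrite rcons_path cat_path /= st !andbT.
Qed.

(** Each letter of [h] cancels at most one letter of [g], at the right end, so a prefix of [g] that
    leaves room for all of [h] survives. *)
Lemma take_fg_mul r (g h : free_group r) m :
  m + size (val h) <= size (val g) -> take m (val (g * h)%g) = take m (val g).
Proof.
(* Allowing all words [w], reduced or not, frees the induction on letters from side conditions. *)
suff take_word w : forall g : free_group r, m + size w <= size (val g) ->
    take m (val (g * fg_word w)%g) = take m (val g).
  by move=> /take_word; rewrite fg_word_val.
elim: w => [|s w IH] {}g; first by rewrite mulg1.
rewrite [size _]/= addnS [fg_word _]/= mulgA => mg.
have mw : m <= m + size w by exact: leq_addr.
have [e|e] := mulg_letterr g s.
- rewrite IH e ?size_rcons; last by apply: leqW; apply: ltnW.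
  by rewrite -cats1 takel_cat // ltnW // (leq_ltn_trans mw).
- have mg' : m + size w <= size (val (g * fg_letter s)%g).
    by rewrite e size_rcons ltnS in mg.
  by rewrite IH // e -cats1 takel_cat // (leq_trans mw).
Qed.

(** * A cocycle of the free group over [Z/n] *)

Section Cocycle.
Variables (r n : nat).
Implicit Types (x y : 'I_r) (s : letter r) (k i : 'I_n) (g h : free_group r).

(** The free group acts on [Z/n] by translation through the exponent sum of [x]; this is the action
    of one letter. *)
Definition state_step x s i : 'I_n :=
  if s.1 == x then if s.2 then ordS i else ord_pred i else i.

Lemma state_stepK x s : cancel (state_step x s) (state_step x (linv s)).
Proof.
by move=> i; rewrite /state_step /=; case: eqP => // _; case: s.2;
  rewrite ?ordSK ?ord_predK.
Qed.

Lemma state_stepVK x s : cancel (state_step x (linv s)) (state_step x s).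
Proof. by move=> i; rewrite -{1}[s]linvK state_stepK. Qed.

(* Comes from the isomorphism between the kernels of the exponent sums modulo
   [n] of [x] and of [y] that, up to exchanging [x] and [y], is the involution
   [x^n |-> y], [x^-k y x^k |-> x^-k y x^k (y^-1 x^n)]; [k] is the state after
   reading [j]. Exchanging [x] and [y] in the formula gives the inverse. *)
Definition cocycle_gen x y j k : free_group r :=
  (if j == x then if val k == 0 then gen x * (gen y ^+ n.-1)^-1 else gen y
   else if j == y then gen x * gen y ^+ k * (gen x)^-1 * gen y ^+ (n - k)
   else gen j)%g.

(** The value at an inverse letter is forced by the cocycle identity: the state before it is the
    state after the positive letter. *)
Definition cocycle_letter x y s k : free_group r :=
  if s.2 then cocycle_gen x y s.1 k
  else (cocycle_gen x y s.1 (state_step x (linv s) k))^-1%g.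

Lemma cocycle_letterV x y s k :
  cocycle_letter x y (linv s) k =
  (cocycle_letter x y s (state_step x s k))^-1%g.
Proof.
by case: s => j [//|]; rewrite /cocycle_letter invgK /= state_stepK.
Qed.

(* The state is read off backwards: [k] is the state reached after [w]. *)
Fixpoint cocycle x y k (w : seq (letter r)) : free_group r :=
  if w is s :: w' then
    (cocycle_letter x y s k * cocycle x y (state_step x (linv s) k) w')%g
  else 1%g.

Definition state_before x k (w : seq (letter r)) : 'I_n :=
  foldl (fun i s => state_step x (linv s) i) k w.

(** The factors of two adjacent inverse letters cancel, so [cocycle] respects reduction; the cocycle
    identity for products follows. *)
Lemma cocycle_lcons x y k s w :
  cocycle x y k (lcons s w) =
  (cocycle_letter x y s k * cocycle x y (state_step x (linv s) k) w)%g.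
Proof.
case: w => [|t w] //=; case: eqP => [->|//] /=.
by rewrite mulgA cocycle_letterV state_stepVK mulgV mul1g linvK state_stepVK.
Qed.

Lemma state_before_lcons x k s w :
  state_before x k (lcons s w) = state_before x (state_step x (linv s) k) w.
Proof.
by case: w => [|t w] //=; case: eqP => [->|//] /=; rewrite linvK state_stepVK.
Qed.

Lemma cocycleM x y k g h :
  cocycle x y k (val (g * h)%g) =
  (cocycle x y k (val g) * cocycle x y (state_before x k (val g)) (val h))%g.
Proof.
rewrite /=; elim: (val g) k => [|s w IH] k /=; first by rewrite mul1g.
by rewrite cocycle_lcons IH mulgA.
Qed.

Lemma state_beforeM x k g h :
  state_before x k (val (g * h)%g) =
  state_before x (state_before x k (val g)) (val h).
Proof.
rewrite /=; elim: (val g) k => [|s w IH] k //=.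
by rewrite state_before_lcons IH.
Qed.

Lemma state_beforeV x k g :
  state_before x (state_before x k (val g)) (val g^-1%g) = k.
Proof. by rewrite -state_beforeM mulgV. Qed.

Lemma cocycleV x y k g :
  cocycle x y (state_before x k (val g)) (val g^-1%g) =
  (cocycle x y k (val g))^-1%g.
Proof.
by apply: (mulgI (cocycle x y k (val g))); rewrite -cocycleM !mulgV.
Qed.

Lemma cocycle_gen1 x y j k :
  cocycle x y k (val (gen j)) = cocycle_gen x y j k.
Proof. by rewrite /= mulg1. Qed.

Lemma val_ord_pred k : 0 < k -> ord_pred k = k.-1 :> nat.
Proof.
move=> k0; rewrite /= -[X in (X + _).-1](prednK k0) addSn /= modnDr.
rewrite modn_small //.
exact: leq_ltn_trans (leq_pred k) (ltn_ord k).
Qed.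

Lemma val_ord_pred0 k : val k = 0 -> ord_pred k = n.-1 :> nat.
Proof.
move=> /= ->; rewrite add0n modn_small // ltn_predL.
exact: leq_ltn_trans (ltn_ord k).
Qed.

(** The letters, from left to right, are read at the states [k, k - 1, ..., k - j + 1], all nonzero,
    so every [x] contributes [y]. *)
Lemma cocycle_expg x y j k : j <= k ->
  cocycle x y k (val (gen x ^+ j)%g) = (gen y ^+ j)%g /\
  val (state_before x k (val (gen x ^+ j)%g)) = k - j.
Proof.
elim: j k => [|j IH] k jk; first by rewrite !expg0 subn0.
have k0 : 0 < k by exact: leq_trans jk.
rewrite !expgS cocycleM state_beforeM cocycle_gen1 /cocycle_gen eqxx.
rewrite -[val k == 0]negbK -lt0n k0 /= /state_step /= eqxx.
have [| -> ->] := IH (ord_pred k).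
  by rewrite val_ord_pred // -ltnS prednK.
by rewrite val_ord_pred // -subn1 -subnDA add1n.
Qed.

Lemma cocycle_genK x y : x != y -> forall j k,
  cocycle y x k (val (cocycle_gen x y j k)) = gen j /\
  state_before y k (val (cocycle_gen x y j k)) = state_step x (j, false) k.
Proof.
move=> xy j k; rewrite [cocycle_gen x y j k]/cocycle_gen.
have yx := xy; rewrite eq_sym in yx.
have genX i : cocycle y x i (val (gen x)) =
    (gen y * gen x ^+ i * (gen y)^-1 * gen x ^+ (n - i))%g.
  by rewrite cocycle_gen1 /cocycle_gen (negbTE xy) eqxx.
have stX i : state_before y i (val (gen x)) = i.
  by rewrite /= /state_step /= (negbTE xy).
have stY i : state_before y i (val (gen y)) = ord_pred i.
  by rewrite /= /state_step /= eqxx.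
have n0 : 0 < n by exact: leq_ltn_trans (ltn_ord k).
case: (eqVneq j x) => [->|jx].
  rewrite /state_step /= eqxx; case: (eqVneq (val k) 0) => k0; last first.
    by rewrite cocycle_gen1 stY /cocycle_gen eqxx (negbTE k0).
  (* In state [0] the factor [x] contributes [x^n], and [y^-(n-1)] contributes [x^-(n-1)]. *)
  have [|e1 e2] := @cocycle_expg y x n.-1 (ord_pred k).
    by rewrite val_ord_pred0.
  have e3 : state_before y (ord_pred k) (val (gen y ^+ n.-1)%g) = k.
    by apply: val_inj; rewrite e2 val_ord_pred0 // subnn -k0.
  rewrite cocycleM state_beforeM stX genX -[X in cocycle y x X]e3 cocycleV e1.
  rewrite -[X in state_before y X]e3 state_beforeV; split => //.
  rewrite k0 expg0 mulg1 mulgV mul1g subn0 -[X in (gen x ^+ X)%g]prednK //.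
  by rewrite expgS mulgK.
case: (eqVneq j y) => [->|jy]; last first.
  rewrite cocycle_gen1 /cocycle_gen (negbTE jx) (negbTE jy) /= /state_step /=.
  by rewrite (negbTE jx) (negbTE jy).
have -> : state_step x (y, false) k = k by rewrite /state_step /= (negbTE yx).
(* The pieces of [x y^k x^-1 y y^(n-1-k)] are read at the states [k, k, 0, 0, n-1], and their
   contributions multiply to [(y x^k y^-1 x^(n-k)) x^k x^-n (y x^-(n-1)) x^(n-1-k) = y]. *)
have [e1 e2] := @cocycle_expg y x k k (leqnn k).
set k0 := state_before y k (val (gen y ^+ k)%g) in e2.
rewrite subnn in e2.
have nk : n - k = (n.-1 - k).+1 by rewrite -subSn ?prednK // -ltnS prednK.
have [|e3 e4] := @cocycle_expg y x (n.-1 - k) (ord_pred k0).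
  by rewrite val_ord_pred0 // leq_subr.
have e5 : state_before y k0 (val ((gen x)^-1)%g) = k0.
  by rewrite -{1}(stX k0) state_beforeV.
have e6 : cocycle y x k0 (val ((gen x)^-1)%g) = ((gen x ^+ n)^-1)%g.
  rewrite -{1}(stX k0) cocycleV genX e2 expg0 mulg1 mulgV mul1g.
  by rewrite subn0.
rewrite !cocycleM !state_beforeM stX -/k0 e5 nk expgS.
rewrite cocycleM state_beforeM stY.
split; last first.
  apply: val_inj; rewrite e4 val_ord_pred0 // subKn //.
  by rewrite -ltnS prednK.
rewrite e1 e3 genX e6 cocycle_gen1 /cocycle_gen eqxx e2 eqxx.
have kn : k <= n.-1 by rewrite -ltnS prednK.
have h1 : (gen x ^+ (n - k) * gen x ^+ k)%g = (gen x ^+ n)%g.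
  by rewrite -expgnDr subnK // ltnW.
have h2 : ((gen x ^+ n.-1)^-1 * gen x ^+ (n.-1 - k))%g = ((gen x ^+ k)^-1)%g.
  by rewrite -{1}(subnK kn) expgnDr invgM mulgVK.
rewrite -(mulgA (_ / _)%g (gen x ^+ (n - k))%g) h1 mulgK.
by rewrite -(mulgA (gen y) _ (gen x ^+ (n.-1 - k))%g) h2 mulgA mulgVK mulgK.
Qed.

Lemma cocycle_letterK x y : x != y -> forall s k,
  cocycle y x k (val (cocycle_letter x y s k)) = fg_letter s /\
  state_before y k (val (cocycle_letter x y s k)) = state_step x (linv s) k.
Proof.
move=> xy [j []] k; first exact: cocycle_genK.
rewrite [cocycle_letter _ _ _ _]/cocycle_letter /=.
set i := state_step _ _ k; have [e1 e2] := cocycle_genK xy j i.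
have ki : k = state_before y i (val (cocycle_gen x y j i)).
  by rewrite e2 /i (state_stepK x (j, true)).
clearbody i; rewrite ki cocycleV e1 state_beforeV.
by split=> //; exact: val_inj.
Qed.

(** Serves twice: for the lower bound on the length of images and for the inverse of the boundary
    maps. *)
Lemma cocycleK x y : x != y -> forall w k,
  cocycle y x k (val (cocycle x y k w)) = fg_word w /\
  state_before y k (val (cocycle x y k w)) = state_before x k w.
Proof.
move=> xy; elim=> [|s w IH] k //.
have [e1 e2] := cocycle_letterK xy s k.
have [e3 e4] := IH (state_step x (linv s) k).
by rewrite [cocycle x y k _]/= cocycleM state_beforeM e1 e2 e3 e4.
Qed.

End Cocycle.

(** * The induced maps of the boundary *)

Section BoundaryWords.
Variable r : nat.
Implicit Types (u : nat -> seq (letter r)) (f : nat -> letter r).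
Implicit Types (s : letter r) (g : free_group r) (w : boundary r).

(** Boundary points are treated as limits of finite words: identities in the free group pass to the
    boundary by uniqueness of limits. *)
Definition word_cvg u f :=
  forall m, exists N, forall j, N <= j -> take m (u j) = mkseq f m.

Lemma take_mkseq f m j : m <= j -> take m (mkseq f j) = mkseq f m.
Proof. by move=> mj; rewrite -map_take take_iota (minn_idPl mj). Qed.

Lemma word_cvg_mkseq f : word_cvg (mkseq f) f.
Proof. by move=> m; exists m => j; exact: take_mkseq. Qed.

Lemma word_cvg_unique u f f' : word_cvg u f -> word_cvg u f' -> f = f'.
Proof.
move=> uf uf'; apply: funext => m.
have [N fN] := uf m.+1; have [N' fN'] := uf' m.+1.
have := fN _ (leq_maxl N N'); rewrite fN' ?leq_maxr // => e.
by have := congr1 (nth (f m) ^~ m) e; rewrite !nth_mkseq.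
Qed.

Lemma reduced_mkseq w j : reduced (mkseq (val w) j).
Proof.
apply/(sortedP (val w 0)) => i; rewrite size_mkseq => ij.
rewrite !nth_mkseq //; last exact: ltnW.
exact: (set_mem (valP w)).
Qed.

Lemma mkseq_boundary f :
  (forall j, reduced (mkseq f j)) -> f \in @boundary_set r.
Proof.
move=> rf; apply/mem_set => j; have /(sortedP (f 0)) /(_ j) := rf j.+2.
by rewrite size_mkseq !nth_mkseq //; exact.
Qed.

Lemma word_cvg_lcons s u w :
  word_cvg u (val w) -> word_cvg (fun j => lcons s (u j)) (val (bcons s w)).
Proof.
(* [lcons] may delete the first letter, so [m + 1] letters of [u j] must be settled. *)
move=> uw m; have [N uN] := uw m.+1; exists N => j /uN {uN} uj.
have mkseq_head f i : mkseq f i.+1 = f 0 :: mkseq (f \o S) i.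
  by rewrite /mkseq /= -(addn0 1) iotaDl -map_comp.
rewrite /= /bcons_fun; case: (u j) uj => [//|t v] tv.
have t0 : t = val w 0 by case: tv.
rewrite /= t0; case: ifP => _; first by move: tv; rewrite mkseq_head => -[].
case: m tv => [//|m] tv; rewrite [RHS]mkseq_head -t0 /=; congr cons.
by have /(congr1 (take m)) := tv; rewrite take_takel ?take_mkseq // leqW.
Qed.

Lemma word_cvg_mul g (h : nat -> free_group r) w :
  word_cvg (fun j => val (h j)) (val w) ->
  word_cvg (fun j => val (g * h j)%g) (val (boundary_action r g w)).
Proof.
move=> hw /=; elim: (val g) => [//|s v IH] /=.
have -> : letter_act (@boundary_gen r) s = bcons s by case: s => i [].
exact: word_cvg_lcons.
Qed.

Lemma near_prefix w N : \forall w' \near w, mkseq (val w') N = mkseq (val w) N.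
Proof.
elim: N => [|N IH]; first exact: filterE.
near=> w'; rewrite !mkseqS; have -> : val w' N = val w N.
  by near: w'; exact: near_coord.
by congr rcons; near: w'.
Unshelve. all: by end_near. Qed.

End BoundaryWords.

Section BoundaryMap.
Variables (r n : nat).
Implicit Types (x y : 'I_r) (s : letter r) (k i : 'I_n) (g h : free_group r).
Implicit Types (w : boundary r).

(** A Lipschitz constant for word lengths under [cocycle x y] and [cocycle y x] alike; the successor
    makes it positive. *)
Definition cocycle_bound x y : nat :=
  (\max_s \max_(k < n) maxn (size (val (cocycle_letter x y s k)))
                            (size (val (cocycle_letter y x s k)))).+1.

Lemma cocycle_boundC x y : cocycle_bound y x = cocycle_bound x y.
Proof.
by congr _.+1; apply: eq_bigr => s _; apply: eq_bigr => k _; rewrite maxnC.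
Qed.

Lemma cocycle_letter_bound x y s k :
  size (val (cocycle_letter x y s k)) <= cocycle_bound x y.
Proof.
apply/leqW/(leq_trans _ (leq_bigmax s)).
apply: leq_trans (leq_bigmax (F := fun k : 'I_n => maxn _ _) k).
exact: leq_maxl.
Qed.

Lemma size_cocycle x y k u :
  size (val (cocycle x y k u)) <= cocycle_bound x y * size u.
Proof.
elim: u k => [|s u IH] k; first by rewrite muln0.
rewrite mulnS; apply: leq_trans (size_fg_mul _ _) _.
by apply: leq_add => //; exact: cocycle_letter_bound.
Qed.

Lemma cocycle_rcons x y k u s :
  cocycle x y k (rcons u s) =
  (cocycle x y k u * cocycle_letter x y s (state_before x k u))%g.
Proof.
by elim: u k => [|t u IH] k /=; rewrite ?mulg1 ?mul1g // IH mulgA.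
Qed.

Variables (x y : 'I_r).
Hypothesis xy : x != y.

(** The inverse cocycle obeys the same upper bound, applied here to the image of [u]. *)
Lemma size_cocycle_ge k u : reduced u ->
  size u <= cocycle_bound x y * size (val (cocycle x y k u)).
Proof.
move=> ru; have [e _] := cocycleK xy u k; rewrite -cocycle_boundC.
have {1}-> : u = val (fg_word u).
  by rewrite -[u]/(val (exist _ u ru : free_group r)) fg_word_val.
by rewrite -e size_cocycle.
Qed.

(* A word [u] with [stable_size m <= size u] has image of length at least
   [m + cocycle_bound x y], and appending one letter to [u] then leaves the
   first [m] letters of the image unchanged. *)
Definition stable_size m : nat :=
  cocycle_bound x y * (m + cocycle_bound x y).

Lemma cocycle_stable k u m j :
  reduced u -> stable_size m <= j <= size u ->
  take m (val (cocycle x y k u)) = take m (val (cocycle x y k (take j u))).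
Proof.
elim/last_ind: u => [//|u s IH] rus /andP[mj].
rewrite size_rcons leq_eqVlt => /orP[/eqP ->|ju].
  by rewrite -(size_rcons u s) take_size.
rewrite -cats1 takel_cat // cats1 cocycle_rcons.
have ru : reduced u by move: rus; rewrite -cats1 => /reduced_catl.
rewrite -(IH ru) ?mj // take_fg_mul //.
apply: leq_trans (leq_add (leqnn m) (cocycle_letter_bound _ _ _ _)) _.
rewrite -(leq_pmul2l (isT : 0 < cocycle_bound x y)).
apply: leq_trans (size_cocycle_ge k ru).
exact: leq_trans mj ju.
Qed.

(** The prefix is so long that later letters of [w] do not affect letter [m] of the image, and that
    the default of [nth] is never returned. *)
Definition boundary_map_fun k w : nat -> letter r := fun m =>
  nth (x, true)
    (val (cocycle x y k (mkseq (val w) (stable_size m.+1)))) m.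

Lemma stable_size_mono m m' : m <= m' -> stable_size m <= stable_size m'.
Proof. by move=> mm; rewrite leq_mul2l leq_add2r mm orbT. Qed.

Lemma boundary_map_prefix k w m j : stable_size m <= j ->
  take m (val (cocycle x y k (mkseq (val w) j))) =
  mkseq (boundary_map_fun k w) m.
Proof.
move=> mj; have size_m : m <= size (val (cocycle x y k (mkseq (val w) j))).
  rewrite -(leq_pmul2l (isT : 0 < cocycle_bound x y)).
  apply: leq_trans (size_cocycle_ge k (reduced_mkseq w j)).
  by rewrite size_mkseq; apply: leq_trans mj; rewrite leq_mul2l leq_addr orbT.
apply: (@eq_from_nth _ (x, true)) => [|i].
  by rewrite size_takel // size_mkseq.
rewrite size_takel // => im; rewrite nth_mkseq // /boundary_map_fun.
have ij : stable_size i.+1 <= j by apply: leq_trans (stable_size_mono im) mj.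
rewrite nth_take // -(nth_take _ (ltnSn i)) -[RHS](nth_take _ (ltnSn i)).
rewrite (@cocycle_stable _ _ _ (stable_size i.+1)) ?reduced_mkseq //.
  by rewrite take_mkseq.
by rewrite leqnn size_mkseq.
Qed.

Lemma boundary_map_subproof k w :
  boundary_map_fun k w \in @boundary_set r.
Proof.
apply: mkseq_boundary => j; rewrite -(boundary_map_prefix k w (leqnn _)).
have := valP (cocycle x y k (mkseq (val w) (stable_size j))).
by rewrite -{1}(cat_take_drop j (val _)) => /reduced_catl.
Qed.

Definition boundary_map k w : boundary r :=
  exist _ (boundary_map_fun k w) (boundary_map_subproof k w).

Lemma word_cvg_cocycle k (u : nat -> free_group r) w :
  word_cvg (fun j => val (u j)) (val w) ->
  word_cvg (fun j => val (cocycle x y k (val (u j)))) (val (boundary_map k w)).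
Proof.
move=> uw m; have [N uN] := uw (stable_size m); exists N => j /uN {uN} uj.
rewrite -(boundary_map_prefix k w (leqnn _)) -uj.
apply: cocycle_stable; first exact: valP.
rewrite leqnn -(size_mkseq (val w) (stable_size m)) -uj.
by rewrite size_take_min geq_minr.
Qed.

Definition prefix_word w j : free_group r :=
  exist (fun v => is_true (reduced v)) (mkseq (val w) j) (reduced_mkseq w j).

(** Both sides are limits of the same words, by the cocycle identity for products of [g] with
    prefixes of [w]. *)
Lemma boundary_mapM k g w :
  boundary_map k (boundary_action r g w) =
  boundary_action r (cocycle x y k (val g))
    (boundary_map (state_before x k (val g)) w).
Proof.
apply: val_inj; apply: (word_cvg_unique (u := fun j =>
  val (cocycle x y k (val (g * prefix_word w j)%g)))).
  exact/word_cvg_cocycle/word_cvg_mul/word_cvg_mkseq.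
under [X in word_cvg X]eq_fun do rewrite cocycleM.
exact/word_cvg_mul/word_cvg_cocycle/word_cvg_mkseq.
Qed.

Lemma near_boundary_map k w m :
  \forall w' \near w, val (boundary_map k w') m = val (boundary_map k w) m.
Proof.
by apply: filterS (near_prefix w (stable_size m.+1)) => w' e;
  rewrite /= /boundary_map_fun e.
Qed.

End BoundaryMap.

Lemma boundary_mapK r n (x y : 'I_r) (xy : x != y) (yx : y != x) (k : 'I_n) w :
  boundary_map yx k (boundary_map xy k w) = w.
Proof.
apply: val_inj; apply: (word_cvg_unique (u := fun j =>
  val (cocycle y x k (val (cocycle x y k (val (prefix_word w j))))))).
  exact/word_cvg_cocycle/word_cvg_cocycle/word_cvg_mkseq.
rewrite [X in word_cvg X](_ : _ = mkseq (val w)); first exact: word_cvg_mkseq.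
apply: funext => j; have [-> _] := cocycleK xy (val (prefix_word w j)) k.
by rewrite fg_word_val.
Qed.

(** * Exponent sums *)

Section ExponentSum.
Variables (r n : nat).
Implicit Types (x y z : 'I_r) (s : letter r) (k i : 'I_n) (g h : free_group r).

Definition letter_exponent z s : int :=
  (if s.1 == z then if s.2 then 1 else -1 else 0)%R.

Definition exponent_sum z (w : seq (letter r)) : int :=
  foldr (fun s e => letter_exponent z s + e)%R 0%R w.

Lemma exponent_sumM z g h :
  exponent_sum z (val (g * h)%g) =
  (exponent_sum z (val g) + exponent_sum z (val h))%R.
Proof.
have lconsE s w : exponent_sum z (lcons s w) =
    (letter_exponent z s + exponent_sum z w)%R.
  case: w => [|t w] //=; case: eqP => [->|//].
  rewrite /letter_exponent /=; case: eqP => _; case: s.2 => /=; lia.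
rewrite /=; elim: (val g) => [|s w IH] /=; first by rewrite add0r.
by rewrite lconsE IH addrA.
Qed.

Lemma exponent_sumV z g :
  exponent_sum z (val g^-1%g) = (- exponent_sum z (val g))%R.
Proof.
apply: (addrI (exponent_sum z (val g))).
by rewrite -exponent_sumM mulgV subrr.
Qed.

Lemma exponent_sumX z g j :
  exponent_sum z (val (g ^+ j)%g) = (exponent_sum z (val g) * j%:Z)%R.
Proof.
elim: j => [|j IH]; first by rewrite expg0 mulr0.
by rewrite expgS exponent_sumM IH; lia.
Qed.

Lemma exponent_sum_gen z j : exponent_sum z (val (gen j)) = (j == z)%:Z%R.
Proof. by rewrite /= addr0 /letter_exponent /=; case: eqP. Qed.

(** Here [i] and [k] are the states before and after a word with exponent sums [dx], [dy] and
    cocycle value [e]. Moving [i + n u] by [dx] gives [k + n u'], with [u'] the shift of [u] by the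
    exponent of [x] in [e]; moving [i + n v] by the exponent of [y] in [e] gives [k + n v'], with
    [v'] the shift of [v] by [dy]. *)
Definition cocycle_exponents x y k i (e : free_group r) (dx dy : int) :=
  (k%:Z + n%:Z * exponent_sum x (val e) = i%:Z + dx /\
   i%:Z + exponent_sum y (val e) = k%:Z + n%:Z * dy)%R.

Lemma cocycle_gen_exponents x y j k : x != y ->
  cocycle_exponents x y k (state_step x (j, false) k) (cocycle_gen x y j k)
    (j == x)%:Z%R (j == y)%:Z%R.
Proof.
move=> xy; have yx := xy; rewrite eq_sym in yx.
have n0 : 0 < n by exact: leq_ltn_trans (ltn_ord k).
rewrite /cocycle_exponents /cocycle_gen /state_step [fst _]/= [snd _]/=.
case: (eqVneq j x) => [->|jx].
  case: (eqVneq (val k) 0) => k0.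
    rewrite !exponent_sumM !exponent_sumV !exponent_sumX !exponent_sum_gen.
    rewrite val_ord_pred0 // !eqxx (negbTE xy) (negbTE yx) /=.
    by have : nat_of_ord k = 0 by []; lia.
  rewrite !exponent_sum_gen val_ord_pred ?lt0n // !eqxx.
  rewrite (negbTE xy) (negbTE yx) /=.
  by have : nat_of_ord k != 0 by []; lia.
case: (eqVneq j y) => [_|jy].
  rewrite !exponent_sumM !exponent_sumV !exponent_sumX !exponent_sum_gen.
  have := ltn_ord k.
  rewrite !eqxx (negbTE xy) (negbTE yx) /=; nia.
rewrite !exponent_sum_gen (negbTE jx) (negbTE jy) /=; lia.
Qed.

Lemma cocycle_letter_exponents x y s k : x != y ->
  cocycle_exponents x y k (state_step x (linv s) k) (cocycle_letter x y s k)
    (letter_exponent x s) (letter_exponent y s).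
Proof.
move=> xy; case: s => j [].
  have := cocycle_gen_exponents j k xy; rewrite /letter_exponent /=.
  by case: (j == x); case: (j == y).
rewrite /cocycle_letter /=; set i := state_step _ _ k.
have := cocycle_gen_exponents j i xy.
have -> : state_step x (j, false) i = k by exact: (state_stepK x (j, true)).
rewrite /cocycle_exponents !exponent_sumV /letter_exponent /=.
by case: (j == x); case: (j == y); lia.
Qed.

(** The relations add up along a word, the intermediate states cancelling. *)
Lemma cocycle_exponentsP x y w k : x != y ->
  cocycle_exponents x y k (state_before x k w) (cocycle x y k w)
    (exponent_sum x w) (exponent_sum y w).
Proof.
move=> xy; elim: w k => [|s w IH] k.
  by rewrite /cocycle_exponents /=; lia.
move: (IH (state_step x (linv s) k)) (cocycle_letter_exponents s k xy).
rewrite /cocycle_exponents [cocycle x y k _]/= !exponent_sumM.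
rewrite [state_before x k _]/= -/(state_before _ _ _).
rewrite ![exponent_sum _ (s :: w)]/= !mulrDr; lia.
Qed.

End ExponentSum.

(** * The groups [Z/M] *)

Section Presentations.
Variables (M : supernatural) (m : presentation M).

Lemma pseq_dvd_leq k k' : k <= k' -> m k %| m k'.
Proof.
move=> /subnK <-; elim: (k' - k) => [//|j]; rewrite addSn => /dvdn_trans; apply.
exact: pseq_dvd.
Qed.

Lemma pseq_logn_leq l k k' : k <= k' -> logn l (m k) <= logn l (m k').
Proof. by move=> kk'; apply/dvdn_leq_log/pseq_dvd_leq/kk'/pseq_gt0. Qed.

Lemma pseq_logn_cvg l e : prime l -> M l = Some e ->
  exists K, forall k, K <= k -> logn l (m k) = e.
Proof.
move=> pl Ml; have := pseq_cvg m pl; rewrite Ml => /(_ [set e]%classic) [].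
  exact: discrete_set1.
by move=> K _ KP; exists K => k /KP.
Qed.

Lemma pseq_logn_le l e k : prime l -> M l = Some e -> logn l (m k) <= e.
Proof.
move=> pl /(pseq_logn_cvg pl) [K KP].
rewrite -(KP (maxn K k)) ?leq_maxl //.
by apply: pseq_logn_leq; exact: leq_maxr.
Qed.

Lemma pseq_logn_ge l c : prime l -> (if M l is Some e then c <= e else true) ->
  exists K, forall k, K <= k -> c <= logn l (m k).
Proof.
move=> pl; case Ml: (M l) => [e|].
  by move=> ce; have [K KP] := pseq_logn_cvg pl Ml; exists K => k /KP ->.
have := pseq_cvg m pl; rewrite Ml => /(_ [set j | c <= j]%classic) [].
  by exists c.
by move=> K _ KP _; exists K => k /KP.
Qed.

(** This is [c | d M] realized at a finite level: only the finitely many primes of [c] matter, and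
    the largest of their thresholds serves them all. *)
Lemma pseq_dvd_ex c d : 0 < c -> 0 < d ->
    (forall l, prime l ->
       if M l is Some e then logn l c <= logn l d + e else true) ->
  exists K, c %| d * m K.
Proof.
move=> c0 d0 cM.
suff [K KP] : exists K, forall l, l \in primes c ->
    logn l c <= logn l d + logn l (m K).
  exists K; apply/dvdn_partP => // l lc.
  have pl : prime l by move: lc; rewrite mem_primes => /andP[].
  have mK0 := pseq_gt0 m K.
  by rewrite p_part pfactor_dvdn ?muln_gt0 ?d0 // lognM // KP.
have: all prime (primes c) by apply/allP => l; rewrite mem_primes => /andP[].
elim: (primes c) => [_|l s IH /= /andP[pl /IH[K KP]]]; first by exists 0.
have [|K' K'P] := @pseq_logn_ge l (logn l c - logn l d) pl.
  by have := cM l pl; case: (M l) => // e; rewrite leq_subLR.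
exists (maxn K K') => l'; rewrite inE => /orP[/eqP ->|ls].
  by rewrite -leq_subLR K'P // leq_maxr.
apply: leq_trans (KP _ ls) _; rewrite leq_add2l.
by rewrite dvdn_leq_log ?pseq_gt0 // pseq_dvd_leq // leq_maxl.
Qed.

Implicit Types z : Zmod m.

Lemma Zmod_coherent z k k' : k <= k' -> val z k = val z k' %% m k :> nat.
Proof.
have zP := set_mem (valP z).
move=> /subnK <-; elim: (k' - k) => [|j IH]; first by rewrite modn_small.
rewrite IH addSn -(zP (j + k)) modn_dvdm //.
by apply: pseq_dvd_leq; exact: leq_addl.
Qed.

Lemma Zmod_res z d k k' : d %| m k -> d %| m k' -> val z k = val z k' %[mod d].
Proof.
move=> dk dk'; rewrite (Zmod_coherent z (leq_maxl k k')).
by rewrite (Zmod_coherent z (leq_maxr k k')) !modn_dvdm.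
Qed.

(** The relation [z' = z + t], level by level; it spares a group structure on [Zmod]. *)
Definition Zmod_shift (t : int) z z' : Prop :=
  forall k, ((m k)%:Z %| ((val z' k)%:Z - (val z k)%:Z - t)%R)%Z.

Lemma Zmod_eqP z z' :
  (forall k, ((m k)%:Z %| ((val z k)%:Z - (val z' k)%:Z)%R)%Z) -> z = z'.
Proof.
move=> zz'; apply: val_inj; apply: functional_extensionality_dep => k.
apply/val_inj/eqP; have := zz' k; rewrite -eqz_mod_dvd !modz_nat eqz_nat.
by rewrite !modn_small.
Qed.

Lemma Zmod_shift_unique t z z1 z2 :
  Zmod_shift t z z1 -> Zmod_shift t z z2 -> z1 = z2.
Proof.
move=> z1P z2P; apply: Zmod_eqP => k; have := rpredB (z1P k) (z2P k).
by congr (_ %| _)%Z; ring.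
Qed.

Lemma Zmod_shift_trans t t' z1 z2 z3 :
  Zmod_shift t z1 z2 -> Zmod_shift t' z2 z3 -> Zmod_shift (t + t')%R z1 z3.
Proof.
move=> z12 z23 k; have := rpredD (z12 k) (z23 k).
by congr (_ %| _)%Z; ring.
Qed.

Lemma Zmod_shift0 z : Zmod_shift 0%R z z.
Proof. by move=> k; rewrite subrr subr0 dvdz0. Qed.

Lemma Zmod_shift_sym t z z' : Zmod_shift t z z' -> Zmod_shift (- t)%R z' z.
Proof.
move=> zz' k; have := zz' k; rewrite -rpredN.
by congr (_ %| _)%Z; ring.
Qed.

Lemma Zmod_shift_odometer z : Zmod_shift 1%R z (odometer m z).
Proof.
move=> k /=; rewrite -addrA -opprD -eqz_mod_dvd modz_nat .
by rewrite -PoszD modz_nat modn_mod addn1.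
Qed.

Lemma Zmod_shift_odometer_inv z : Zmod_shift (-1)%R z (hinv (odometer m) z).
Proof.
by apply: Zmod_shift_sym; rewrite -{2}(hinvK (odometer m) z);
  exact: Zmod_shift_odometer.
Qed.

Lemma Zmod_point : Zmod m.
Proof.
exists (fun k => Ordinal (pseq_gt0 m k)).
by apply/mem_set => k /=; rewrite mod0n.
Qed.

End Presentations.

(** * The decomposition of [Z/nP] into [Z/n] and [Z/P] *)

Section DivisionByN.
Variables (n : nat) (P : supernatural).
Variables (m : presentation (smul n P)) (m' : presentation P).
Hypothesis n_gt0 : 0 < n.

(** With [pseq_dvd_smul], the moduli [n * m' k] and [m k] are cofinal for divisibility, as both
    describe [nP]. The maps below can thus be computed at any fine enough level, for arbitrary
    presentations. *)
Lemma pseq_smul_dvd k : exists K, n * m' k %| m K.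
Proof.
have [|l pl|K KP] := @pseq_dvd_ex _ m (n * m' k) 1 _ isT.
- by rewrite muln_gt0 n_gt0 pseq_gt0.
- case Pl: (P l) => [e|] /=; rewrite Pl //=.
  by rewrite logn1 lognM ?pseq_gt0 // leq_add2l (pseq_logn_le _ _ pl).
- by exists K; rewrite mul1n in KP.
Qed.

Lemma pseq_dvd_smul k : exists K, m k %| n * m' K.
Proof.
apply: pseq_dvd_ex => // [|l pl]; first exact: pseq_gt0.
case Pl: (P l) => [e|] //; apply: (@pseq_logn_le _ m) => //.
by rewrite /= Pl.
Qed.

Implicit Types (i : 'I_n) (u : Zmod m') (z : Zmod m).

(** Makes the choice of level by [xchoose] immaterial and the values at successive [k]
    compatible. *)
Lemma Zmod_join_res i u k K K' : m k %| n * m' K -> m k %| n * m' K' ->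
  i + n * val u K = i + n * val u K' %[mod m k].
Proof.
move=> kK kK'; rewrite (Zmod_coherent u (leq_maxl K K')).
rewrite (Zmod_coherent u (leq_maxr K K')) !muln_modr.
by rewrite -[LHS]modnDmr -[RHS]modnDmr !modn_dvdm.
Qed.

Definition Zmod_join_fun i u k : 'I_(m k) :=
  Ordinal (ltn_pmod (i + n * val u (xchoose (pseq_dvd_smul k))) (pseq_gt0 m k)).

Lemma Zmod_join_subproof i u : Zmod_join_fun i u \in @Zmod_set _ m.
Proof.
apply/mem_set => k /=; rewrite modn_dvdm ?pseq_dvd //.
apply: Zmod_join_res; last exact: xchooseP (pseq_dvd_smul k).
exact: dvdn_trans (pseq_dvd m k) (xchooseP (pseq_dvd_smul k.+1)).
Qed.

(* The element [i + n u] of [Z/nP]. *)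
Definition Zmod_join i u : Zmod m := 
  exist (fun y => is_true (y \in @Zmod_set _ m)) _ (Zmod_join_subproof i u).

Lemma val_Zmod_join i u k K : m k %| n * m' K ->
  val (Zmod_join i u) k = (i + n * val u K) %% m k :> nat.
Proof. by move=> kK; exact: Zmod_join_res (xchooseP (pseq_dvd_smul k)) kK. Qed.

Definition Zmod_rem z : 'I_n :=
  Ordinal (ltn_pmod (val z (xchoose (pseq_smul_dvd 0))) n_gt0).

Lemma val_Zmod_rem z K : n %| m K -> Zmod_rem z = val z K %% n :> nat.
Proof.
move=> nK; apply: (Zmod_res z _ nK).
exact: dvdn_trans (dvdn_mulr _ (dvdnn n)) (xchooseP (pseq_smul_dvd 0)).
Qed.

Definition Zmod_quo_fun z k : 'I_(m' k) :=
  Ordinal (ltn_pmod (val z (xchoose (pseq_smul_dvd k)) %/ n) (pseq_gt0 m' k)).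

(** The quotient by [n], taken modulo [m' k], depends only on the residue modulo [n * m' k]. *)
Lemma Zmod_quo_res z k K K' : n * m' k %| m K -> n * m' k %| m K' ->
  val z K %/ n = val z K' %/ n %[mod m' k].
Proof.
by move=> kK kK'; rewrite !modn_divl mulnC (Zmod_res z kK kK').
Qed.

Lemma Zmod_quo_subproof z : Zmod_quo_fun z \in @Zmod_set _ m'.
Proof.
apply/mem_set => k /=; rewrite modn_dvdm ?pseq_dvd //.
apply: Zmod_quo_res; last exact: xchooseP (pseq_smul_dvd k).
apply: dvdn_trans (xchooseP (pseq_smul_dvd k.+1)).
by rewrite dvdn_pmul2l // pseq_dvd.
Qed.

Definition Zmod_quo z : Zmod m' := 
  exist (fun y => is_true (y \in @Zmod_set _ m')) _ (Zmod_quo_subproof z).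

Lemma val_Zmod_quo z k K : n * m' k %| m K ->
  val (Zmod_quo z) k = val z K %/ n %% m' k :> nat.
Proof. by move=> kK; exact: Zmod_quo_res (xchooseP (pseq_smul_dvd k)) kK. Qed.

Lemma Zmod_join_rem i u : Zmod_rem (Zmod_join i u) = i.
Proof.
apply: ord_inj; have [K nK] := pseq_smul_dvd 0.
have {}nK : n %| m K := dvdn_trans (dvdn_mulr _ (dvdnn n)) nK.
have [K' KK'] := pseq_dvd_smul K.
rewrite (val_Zmod_rem _ nK) (val_Zmod_join _ _ KK') modn_dvdm //.
by rewrite addnC mulnC modnMDl modn_small.
Qed.

Lemma Zmod_join_quo i u : Zmod_quo (Zmod_join i u) = u.
Proof.
apply: val_inj; apply: functional_extensionality_dep => k; apply: ord_inj.
have [K kK] := pseq_smul_dvd k; have [K' KK'] := pseq_dvd_smul K.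
have kK' : m' k %| m' K' by rewrite -(dvdn_pmul2l n_gt0) (dvdn_trans kK).
rewrite (val_Zmod_quo _ kK) (val_Zmod_join _ _ KK') modn_divl.
rewrite modn_dvdm; last by rewrite mulnC.
rewrite -modn_divl addnC mulnC divnMDl //.
rewrite divn_small // addn0 (Zmod_res u kK' (dvdnn _)) modn_small //.
Qed.

Lemma Zmod_remK z : Zmod_join (Zmod_rem z) (Zmod_quo z) = z.
Proof.
apply: val_inj; apply: functional_extensionality_dep => k; apply: ord_inj.
have [K kK] := pseq_dvd_smul k; have [K' KK'] := pseq_smul_dvd K.
have kK' : m k %| m K' := dvdn_trans kK KK'.
have nK' : n %| m K' := dvdn_trans (dvdn_mulr _ (dvdnn n)) KK'.
rewrite (val_Zmod_join _ _ kK) (val_Zmod_rem _ nK') (val_Zmod_quo _ KK').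
rewrite muln_modr -modnDmr modn_dvdm // modnDmr addnC mulnC -divn_eq.
by rewrite (Zmod_res z kK' (dvdnn _)) modn_small.
Qed.

(** [i' + n u' = i' + n t + n u = i + n u + T], and a shift determines its target. *)
Lemma Zmod_join_shift i i' u u' z (t T : int) :
    (i'%:Z + n%:Z * t = i%:Z + T)%R ->
  Zmod_shift t u u' -> Zmod_shift T (Zmod_join i u) z -> z = Zmod_join i' u'.
Proof.
move=> iT uu' zz; apply: (Zmod_shift_unique zz) => k.
have [K kK] := pseq_dvd_smul k.
have joinE j v : exists c : int, Posz (val (Zmod_join j v) k) =
    ((j%:Z + n%:Z * (val v K)%:Z) - c * (m k)%:Z)%R.
  exists (Posz ((j + n * val v K) %/ m k)); rewrite (val_Zmod_join _ _ kK).
  have := divn_eq (j + n * val v K) (m k); lia.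
have [c ->] := joinE i u; have [c' ->] := joinE i' u'.
have /dvdzP [q qE] := uu' K.
have /dvdnP [a aE] := kK.
(* [c] and [c'] count the multiples of [m k] removed by reduction; [q * m' K] is the error of
   [u' = u + t] at level [K]. *)
apply/dvdzP; exists (q * a%:Z + c - c')%R.
have aZ : (n%:Z * (m' K)%:Z)%R = (a%:Z * (m k)%:Z)%R by rewrite -!PoszM aE.
have -> : Posz (val u' K) = ((val u K)%:Z + t + q * (m' K)%:Z)%R.
  by rewrite -qE; ring.
transitivity ((i'%:Z + n%:Z * t - (i%:Z + T)) + q * (n%:Z * (m' K)%:Z) +
  (c - c') * (m k)%:Z)%R; first by ring.
by rewrite iT aZ; ring.
Qed.

Lemma near_Zmod_join i u k :
  \forall u' \near u, val (Zmod_join i u') k = val (Zmod_join i u) k.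
Proof.
have [K kK] := pseq_dvd_smul k.
apply: filterS (near_coord u K) => u' e; apply: ord_inj.
by rewrite !(val_Zmod_join _ _ kK) e.
Qed.

Lemma near_Zmod_rem z : \forall z' \near z, Zmod_rem z' = Zmod_rem z.
Proof.
apply: filterS (near_coord z (xchoose (pseq_smul_dvd 0))) => z' e.
by apply: val_inj; rewrite /= e.
Qed.

Lemma near_Zmod_quo z k :
  \forall z' \near z, val (Zmod_quo z') k = val (Zmod_quo z) k.
Proof.
apply: filterS (near_coord z (xchoose (pseq_smul_dvd k))) => z' e.
by apply: val_inj; rewrite /= e.
Qed.

End DivisionByN.

(** * Continuous orbit equivalence *)

Section OdometerCoordinates.
Variables (r : nat) (M1 M2 : supernatural).
Variables (m1 : presentation M1) (m2 : presentation M2).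
Variables (x y : 'I_r).
Hypotheses (x0 : val x = 0) (y1 : val y = 1).
Implicit Types (g : free_group r) (t : odo_space r m1 m2).

Lemma odo_letter s t (t' := letter_act (odo_gen m1 m2) s t) :
  [/\ t'.1.1 = letter_act (@boundary_gen r) s t.1.1,
      Zmod_shift (letter_exponent x s) t.1.2 t'.1.2 &
      Zmod_shift (letter_exponent y s) t.2 t'.2].
Proof.
rewrite {}/t'; case: s => [[j jr] b]; rewrite /letter_exponent /letter_act.
rewrite /odo_gen -!val_eqE x0 y1; case: t => [[w z] v].
by case: j jr => [|[|j]] jr; case: b; split => //=;
  do ?[exact: Zmod_shift0|exact: Zmod_shift_odometer
      |exact: Zmod_shift_odometer_inv].
Qed.

Lemma odo_actionE g t (t' := odo_action r m1 m2 g t) :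
  [/\ t'.1.1 = boundary_action r g t.1.1,
      Zmod_shift (exponent_sum x (val g)) t.1.2 t'.1.2 &
      Zmod_shift (exponent_sum y (val g)) t.2 t'.2].
Proof.
rewrite {}/t' /=; elim: (val g) => [|s w [IH1 IH2 IH3]] /=.
  by split=> //; exact: Zmod_shift0.
have [-> s2 s3] := odo_letter s (foldr (letter_act (odo_gen m1 m2)) t w).
rewrite IH1 addrC; split=> //; first exact: Zmod_shift_trans IH2 s2.
by rewrite addrC; exact: Zmod_shift_trans IH3 s3.
Qed.

End OdometerCoordinates.

Lemma continuous_pair (A B C : topologicalType) (f : A -> B) (h : A -> C) :
  continuous f -> continuous h -> continuous (fun t => (f t, h t)).
Proof. by move=> cf ch t; apply: cvg_pair; [exact: cf|exact: ch]. Qed.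

Lemma continuous_fst2 (A B C : topologicalType) :
  continuous (fun t : A * B * C => t.1.1).
Proof.
by move=> t; apply: (@continuous_comp _ _ _ fst fst); exact: cvg_fst.
Qed.

Lemma continuous_snd2 (A B C : topologicalType) :
  continuous (fun t : A * B * C => t.1.2).
Proof.
by move=> t; apply: (@continuous_comp _ _ _ fst snd);
  [exact: cvg_fst|exact: cvg_snd].
Qed.

Lemma continuous_snd (A B : topologicalType) :
  continuous (fun t : A * B => t.2).
Proof. by move=> t; exact: cvg_snd. Qed.

Lemma discrete_cocycle_cont r n (X : topologicalType) (i : X -> 'I_n)
    (c : free_group r -> 'I_n -> free_group r) :
  (forall t, \forall t' \near t, i t' = i t) ->
  continuous (fun gt : discrete_topology (free_group r) * X =>
    c gt.1 (i gt.2) : discrete_topology (free_group r)).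
Proof.
move=> ni [g t]; apply: cvg_near_cst.
have ng := @cvg_fst _ _ _ _ (nbhs_filter t) _
  (discrete_set1 (g : discrete_topology (free_group r))).
have nt := @cvg_snd _ _ _ _
  (nbhs_filter (g : discrete_topology (free_group r))) _ (ni t).
apply: (@filterS2 _ _ (nbhs_filter (g, t)) _ _ _ _ ng nt).
by move=> [g' t'] /= -> ->.
Qed.

Section OrbitEquivalence.
Variables (r n : nat) (x y : 'I_r) (P Q : supernatural).
Variables (m1 : presentation (smul n P)) (m2 : presentation Q).
Variables (n1 : presentation P) (n2 : presentation (smul n Q)).
Hypotheses (x0 : val x = 0) (y1 : val y = 1) (n_gt0 : 0 < n).

Let xy : x != y. Proof. by rewrite -val_eqE /= x0 y1. Qed.
Let yx : y != x. Proof. by rewrite eq_sym. Qed.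

(** [cocycle] expects the state after the word, whereas a point supplies the state before it. *)
Definition state_after z (g : free_group r) (i : 'I_n) : 'I_n :=
  foldr (state_step z) i (val g).

Lemma state_afterK z g i : state_before z (state_after z g i) (val g) = i.
Proof.
rewrite /state_after /=; elim: (val g) => //= s w.
by rewrite /state_before /= state_stepK.
Qed.

Definition odo_equiv (t : odo_space r m1 m2) : odo_space r n1 n2 :=
  let i := Zmod_rem n1 n_gt0 t.1.2 in
  ((boundary_map xy i t.1.1, Zmod_quo n1 n_gt0 t.1.2),
   Zmod_join n2 n_gt0 i t.2).

Definition odo_equiv_inv (t : odo_space r n1 n2) : odo_space r m1 m2 :=
  let i := Zmod_rem m2 n_gt0 t.2 in
  ((boundary_map yx i t.1.1, Zmod_join m1 n_gt0 i t.1.2),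
   Zmod_quo m2 n_gt0 t.2).

Lemma odo_equivK : cancel odo_equiv odo_equiv_inv.
Proof.
move=> [[w z] v]; rewrite /odo_equiv /odo_equiv_inv /=.
by rewrite Zmod_join_rem Zmod_join_quo Zmod_remK boundary_mapK.
Qed.

Lemma odo_equiv_invK : cancel odo_equiv_inv odo_equiv.
Proof.
move=> [[w z] v]; rewrite /odo_equiv /odo_equiv_inv /=.
by rewrite Zmod_join_rem Zmod_join_quo Zmod_remK boundary_mapK.
Qed.

Definition odo_cocycle (g : free_group r) (t : odo_space r m1 m2) :=
  cocycle x y (state_after x g (Zmod_rem n1 n_gt0 t.1.2)) (val g).

Definition odo_cocycle_inv (g : free_group r) (t : odo_space r n1 n2) :=
  cocycle y x (state_after y g (Zmod_rem m2 n_gt0 t.2)) (val g).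

Lemma odo_equivM g t :
  odo_equiv (odo_action r m1 m2 g t) =
  odo_action r n1 n2 (odo_cocycle g t) (odo_equiv t).
Proof.
have [] := odo_actionE x0 y1 g t.
have [] := odo_actionE x0 y1 (odo_cocycle g t) (odo_equiv t).
move: (odo_action r n1 n2 _ _) (odo_action r m1 m2 g t).
case: t => [[w z] v] [[w2 u2] z2] [[w1 z1] v1].
rewrite /odo_equiv /odo_cocycle [fst _]/= [snd _]/=; set i := Zmod_rem _ _ _.
set k := state_after _ _ _; move=> /= -> uP zP -> zP' vP.
(* The first relation moves [i + n u] in the source, the second [i + n v] in the target; both end
   with the residue [k]. *)
have := cocycle_exponentsP (val g) k xy; rewrite state_afterK => -[e1 e2].
rewrite -{1}(Zmod_remK n1 n_gt0 z) in zP'.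
have -> := Zmod_join_shift e1 uP zP'.
have -> := Zmod_join_shift (esym e2) vP zP.
by rewrite Zmod_join_rem Zmod_join_quo boundary_mapM state_afterK.
Qed.

Lemma odo_equiv_invM g t :
  odo_equiv_inv (odo_action r n1 n2 g t) =
  odo_action r m1 m2 (odo_cocycle_inv g t) (odo_equiv_inv t).
Proof.
have [] := odo_actionE x0 y1 g t.
have [] := odo_actionE x0 y1 (odo_cocycle_inv g t) (odo_equiv_inv t).
move: (odo_action r m1 m2 _ _) (odo_action r n1 n2 g t).
case: t => [[w u] z] [[w2 z2] v2] [[w1 u1] z1].
rewrite /odo_equiv_inv /odo_cocycle_inv [fst _]/= [snd _]/=.
set i := Zmod_rem _ _ _; set k := state_after _ _ _.
move=> /= -> zP vP -> uP zP'.
have := cocycle_exponentsP (val g) k yx; rewrite state_afterK => -[e1 e2].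
rewrite -{1}(Zmod_remK m2 n_gt0 z) in zP'.
have -> := Zmod_join_shift e1 vP zP'.
have -> := Zmod_join_shift (esym e2) uP zP.
by rewrite Zmod_join_rem Zmod_join_quo boundary_mapM state_afterK.
Qed.

Lemma odo_equiv_cont : continuous odo_equiv.
Proof.
(* The residue is locally constant, so near [t] a single boundary map and a single [Zmod_join] are
   involved. *)
have nrem (t : odo_space r m1 m2) :
    \forall t' \near t, Zmod_rem n1 n_gt0 t'.1.2 = Zmod_rem n1 n_gt0 t.1.2.
  exact: (continuous_snd2 (near_Zmod_rem n1 n_gt0 t.1.2)).
apply: continuous_pair; [apply: continuous_pair|];
  apply: continuous_coord => k t.
- have := continuous_fst2
    (near_boundary_map xy (Zmod_rem n1 n_gt0 t.1.2) t.1.1 k).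
  by apply: filterS2 (nrem t) => t' ->.
- exact: (continuous_snd2 (near_Zmod_quo n1 n_gt0 t.1.2 k)).
- have := continuous_snd
    (near_Zmod_join n2 n_gt0 (Zmod_rem n1 n_gt0 t.1.2) t.2 k).
  by apply: filterS2 (nrem t) => t' ->.
Qed.

Lemma odo_equiv_inv_cont : continuous odo_equiv_inv.
Proof.
have nrem (t : odo_space r n1 n2) :
    \forall t' \near t, Zmod_rem m2 n_gt0 t'.2 = Zmod_rem m2 n_gt0 t.2.
  exact: (continuous_snd (near_Zmod_rem m2 n_gt0 t.2)).
apply: continuous_pair; [apply: continuous_pair|];
  apply: continuous_coord => k t.
- have := continuous_fst2
    (near_boundary_map yx (Zmod_rem m2 n_gt0 t.2) t.1.1 k).
  by apply: filterS2 (nrem t) => t' ->.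
- have := continuous_snd2
    (near_Zmod_join m1 n_gt0 (Zmod_rem m2 n_gt0 t.2) t.1.2 k).
  by apply: filterS2 (nrem t) => t' ->.
- exact: (continuous_snd (near_Zmod_quo m2 n_gt0 t.2 k)).
Qed.

Lemma odo_cont_orbit_equiv :
  cont_orbit_equiv (odo_action r m1 m2) (odo_action r n1 n2).
Proof.
exists (Homeo odo_equivK odo_equiv_invK odo_equiv_cont odo_equiv_inv_cont).
exists (fun gt => odo_cocycle gt.1 gt.2), (fun gt => odo_cocycle_inv gt.1 gt.2).
split; last exact: odo_equiv_invM; last exact: odo_equivM.
- apply: (@discrete_cocycle_cont _ _ _ (fun t => Zmod_rem n1 n_gt0 t.1.2)
    (fun g i => cocycle x y (state_after x g i) (val g))) => t.
  exact: (continuous_snd2 (near_Zmod_rem n1 n_gt0 t.1.2)).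
- apply: (@discrete_cocycle_cont _ _ _ (fun t => Zmod_rem m2 n_gt0 t.2)
    (fun g i => cocycle y x (state_after y g i) (val g))) => t.
  exact: (continuous_snd (near_Zmod_rem m2 n_gt0 t.2)).
Qed.

End OrbitEquivalence.

(** * Non-conjugacy *)

(** A coordinate determines all earlier ones, so the sets fixing one coordinate are nested. The
    filter they generate converges to [z] in each coordinate, hence in the product. *)
Lemma Zmod_nbhs (M : supernatural) (m : presentation M) (z : Zmod m)
    (U : set (Zmod m)) :
  nbhs z U -> exists k, forall z' : Zmod m, val z' k = val z k -> U z'.
Proof.
move=> [_ [[V oV <-] Vz VU]].
pose near_z k := [set z' : Zmod m | val z' k = val z k]%classic.
pose F := filter_from setT near_z.
have agree k k' (z' : Zmod m) : k <= k' -> near_z k' z' -> near_z k z'.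
  move=> kk' e; apply: val_inj.
  by rewrite /= (Zmod_coherent z' kk') (Zmod_coherent z kk') e.
have FF : Filter F.
  apply: filter_from_filter => [|k k' _ _]; first by exists 0.
  exists (maxn k k') => // z' e.
  by split; apply: agree e; rewrite ?leq_maxl ?leq_maxr.
have : (set_val @ F --> set_val z)%classic.
  apply/cvg_sup => k W [_ [[W' oW' <-] /= W'z W'W]].
  by exists k => // z' e; apply: W'W; rewrite /= [_ k]e.
move=> /(_ V) [|k _ kV]; first exact: open_nbhs_nbhs.
by exists k => z' /kV; exact: VU.
Qed.

(** * Return times over fixed points of the boundary *)

Section FixedPoint.
Variables (r : nat) (M1 M2 : supernatural).
Variables (m1 : presentation M1) (m2 : presentation M2).
Variables (x y : 'I_r).
Hypotheses (x0 : val x = 0) (y1 : val y = 1).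

Lemma boundary_ray_subproof (j : 'I_r) :
  (fun _ : nat => (j, true)) \in @boundary_set r.
Proof. by apply/mem_set => k; rewrite /linv xpair_eqE andbF. Qed.

Definition boundary_ray (j : 'I_r) : boundary r :=
  exist (fun w => is_true (w \in @boundary_set r)) _ (boundary_ray_subproof j).

Lemma boundary_ray_fixed (j : 'I_r) L :
  boundary_action r (gen j ^+ L)%g (boundary_ray j) = boundary_ray j.
Proof.
have fix1 : boundary_action r (gen j) (boundary_ray j) = boundary_ray j.
  apply: val_inj; apply: funext => k /=.
  by rewrite /bcons_fun /= xpair_eqE andbF; case: k.
elim: L => [|L IH]; first exact: act1.
by rewrite expgS actM IH.
Qed.

Definition ray_point (j : 'I_r) : odo_space r m1 m2 :=
  (boundary_ray j, Zmod_point m1, Zmod_point m2).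

(* The boundary coordinate is fixed, and [m2 k], resp. [m1 k], are return times
   of the only odometer that [gen j] can move. *)
Lemma ray_point_return (j : 'I_r) (U : set (odo_space r m1 m2)) :
    nbhs (ray_point j) U ->
  exists k, U (odo_action r m1 m2
    (gen j ^+ (if j == y then m2 k else m1 k))%g (ray_point j)).
Proof.
move=> [[V1 V2] [[[W1 W2] [W1j W2z] WV1] V2z] VU].
have shift_back (M : supernatural) (m : presentation M) (z z' : Zmod m) k
    (t : int) :
    ((m k)%:Z %| t)%Z -> Zmod_shift t z z' -> val z' k = val z k.
  move=> kt zz'; apply/val_inj/eqP; have := rpredD (zz' k) kt.
  rewrite subrK -eqz_mod_dvd !modz_nat eqz_nat.
  by rewrite !modn_small.
have shift_none (M : supernatural) (m : presentation M) (z z' : Zmod m)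
    (t : int) :
    t = 0%R -> Zmod_shift t z z' -> z' = z.
  by move=> -> zz'; apply: Zmod_shift_unique zz' (Zmod_shift0 z).
have [k1 W2k] := Zmod_nbhs W2z; have [k2 V2k] := Zmod_nbhs V2z.
exists (if j == y then k2 else k1).
set L := (if j == y then _ else _).
apply: VU; have := odo_actionE x0 y1 (gen j ^+ L)%g (ray_point j).
case: (odo_action _ _ _ _ _) => [[b z] v] [].
rewrite (boundary_ray_fixed j L) => /= -> zP vP.
move: zP vP; rewrite !exponent_sumX !exponent_sum_gen => zP vP; split.
  apply: WV1; split; first exact: nbhs_singleton.
  move: zP; rewrite /L /=; case: (eqVneq j y) => [->|_].
    have yx : (y == x) = false by rewrite -val_eqE /= x0 y1.
    rewrite yx => /(shift_none _ _ _ _ _ (mul0r _)) ->.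
    exact: nbhs_singleton.
  by move=> zP; apply: W2k; apply: shift_back zP; rewrite dvdz_mull.
move: vP; rewrite /L /=; case: (eqVneq j y) => [_|_].
  by move=> vP; apply: V2k; apply: shift_back vP; rewrite dvdz_mull.
by move=> /(shift_none _ _ _ _ _ (mul0r _)) ->; exact: nbhs_singleton.
Qed.

End FixedPoint.

Section NotConjugate.
Variables (r : nat) (M1 M2 N1 N2 : supernatural).
Variables (m1 : presentation M1) (m2 : presentation M2).
Variables (n1 : presentation N1) (n2 : presentation N2).
Variables (x y : 'I_r).
Hypotheses (x0 : val x = 0) (y1 : val y = 1).

Lemma conjugate_exponents :
    conjugate_actions (odo_action r m1 m2) (odo_action r n1 n2) ->
  exists2 e : free_group r -> int,
    (forall g h, e (g * h)%g = e g + e h)%R /\ (exists g, e g = 1%R) &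
    forall j k, exists k',
      ((m1 k)%:Z %| (e (gen j) * (if j == y then n2 k' else n1 k')%:Z)%R)%Z.
Proof.
move=> [phi [rho [[sig rhoK sigK] equiv]]].
have sigM g h : sig (g * h)%g = (sig g * sig h)%g.
  by apply: (can_inj rhoK); rewrite sigK gmulfM !sigK.
pose e g := exponent_sum x (val (sig g)).
have eM g h : (e (g * h)%g = e g + e h)%R by rewrite /e sigM exponent_sumM.
have e1 : e 1%g = 0%R by apply: (addrI (e 1%g)); rewrite -eM mulg1 addr0.
have eX g k : (e (g ^+ k)%g = e g * k%:Z)%R.
  elim: k => [|k IH]; first by rewrite expg0 e1 mulr0.
  rewrite expgS eM IH; lia.
exists e; first split=> //.
  by exists (rho (gen x)); rewrite /e rhoK exponent_sum_gen eqxx.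
move=> j k; pose t := ray_point n1 n2 j.
have hinvE h : hinv phi (odo_action r n1 n2 h t) =
    odo_action r m1 m2 (sig h) (hinv phi t).
  by apply: (can_inj (hfunK phi)); rewrite hinvK equiv sigK hinvK.
(* The points whose image has the same [k]-th residue as the image of [t] form a neighbourhood of
   [t]; a return to it forces the shift [e] to vanish modulo [m1 k]. *)
have := @hinv_cont _ _ phi t _
  (@continuous_snd2 _ _ _ _ _ (near_coord (hinv phi t).1.2 k)).
move=> /(ray_point_return x0 y1) [k' ret]; exists k'.
pose g := (gen j ^+ (if j == y then n2 k' else n1 k'))%g.
have {}ret : val (odo_action r m1 m2 (sig g) (hinv phi t)).1.2 k =
    val (hinv phi t).1.2 k by rewrite -hinvE; exact: ret.
have [_ /(_ k) + _] := odo_actionE x0 y1 (sig g) (hinv phi t).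
by rewrite ret subrr sub0r rpredN -/(e _) eX.
Qed.

End NotConjugate.

Lemma odo_not_conjugate (r p q n : nat) (hr : 2 <= r)
    (hp : prime p) (hq : prime q) (hpq : p <> q)
    (hn : 1 < n) (hpn : coprime p n)
    (m1 : presentation (smul n (prime_infty hp)))
    (m2 : presentation (prime_infty hq))
    (n1 : presentation (prime_infty hp))
    (n2 : presentation (smul n (prime_infty hq))) :
  ~ conjugate_actions (odo_action r m1 m2) (odo_action r n1 n2).
Proof.
pose x : 'I_r := Ordinal (ltnW hr); pose y : 'I_r := Ordinal hr.
move=> /(conjugate_exponents (x := x) (y := y) erefl erefl).
move=> [e [eM [g0 eg0]] eD].
have n0 : 0 < n by exact: ltnW.
(* Such a [c] divides [n p^oo], hence some [m1 k], hence [e (gen j)] times a return time; the return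
   time, being prime to [c], can be cancelled. *)
have dvd_e c j : 0 < c ->
    (forall l, prime l -> l != p -> logn l c <= logn l n) ->
    (forall k, coprime c (if j == y then n2 k else n1 k)) ->
  (c%:Z %| e (gen j))%Z.
  move=> c0 cn cco; have [l pl|k ck] := @pseq_dvd_ex _ m1 c 1 c0 isT.
    rewrite /=; case: eqVneq => //= lp; rewrite logn1 add0n addn0; exact: cn.
  have [k' kk'] := eD j k; rewrite mul1n in ck.
  rewrite -(@Gauss_dvdzl _ _ (if j == y then n2 k' else n1 k')) ?coprimezE /=;
    last exact: cco.
  exact: dvdz_trans kk'.
have e_y : e (gen y) = 0%R.
  suff pe a : ((p ^ a)%:Z %| e (gen y))%Z.
    (* A nonzero value is not divisible by the power of [p] whose exponent is its absolute value,
       since that power is larger. *)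
    apply/eqP; rewrite -absz_eq0; apply/negPn/negP; rewrite -lt0n => e0.
    have := dvdn_leq e0 (pe `|e (gen y)|%N); rewrite leqNgt ltn_expl //.
    exact: prime_gt1.
  apply: dvd_e => [|l pl lp|k]; first by rewrite expn_gt0 prime_gt0.
    by rewrite lognX logn_prime // (negbTE lp) muln0.
  rewrite eqxx coprimeXl // prime_coprime //; apply/negP => pk.
  (* The exponent of [p] in [n q^oo] computes to [logn p n + 0], which is zero by coprimality. *)
  have := @pseq_logn_le _ n2 p (logn p n + 0) k hp; rewrite /=.
  case: eqP => // _ /= /(_ erefl); rewrite (logn_coprime hpn).
  by rewrite leqNgt logn_gt0 mem_primes hp pseq_gt0 pk.
have e_n g : (n%:Z %| e g)%Z.
  have e1 : e 1%g = 0%R by apply: (addrI (e 1%g)); rewrite -eM mulg1 addr0.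
  have e_gen j : (n%:Z %| e (gen j))%Z.
    case: (eqVneq j y) => [->|jy]; first by rewrite e_y dvdz0.
    apply: dvd_e => // k; rewrite (negbTE jy).
    (* A prime dividing a modulus of [p^oo] is [p], which does not divide [n]. *)
    rewrite coprime_sym coprime_has_primes ?pseq_gt0 //.
    apply/hasPn => l; rewrite !mem_primes => /and3P[pl _ ln].
    apply/negP => /and3P[_ _ lk].
    have lp : l != p.
      by apply/eqP => lp; move: hpn; rewrite prime_coprime // -lp ln.
    have := @pseq_logn_le _ n1 l 0 k pl; rewrite /= (negbTE lp) => /(_ erefl).
    by rewrite leqNgt logn_gt0 mem_primes pl pseq_gt0 lk.
  rewrite -(fg_word_val g); elim: (val g) => [|[j b] w IH] /=.
    by rewrite e1 dvdz0.
  rewrite eM rpredD //; case: b; first exact: e_gen.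
  have -> : fg_letter (j, false) = (gen j)^-1%g by exact: val_inj.
  have -> : e (gen j)^-1%g = (- e (gen j))%R.
    by apply: (addrI (e (gen j))); rewrite -eM mulgV subrr.
  by rewrite rpredN e_gen.
have := e_n g0; rewrite eg0 dvdz1 absz_nat => /eqP n_1.
by move: hn; rewrite n_1.
Qed.

Theorem theorem3p6 (r p q n : nat) (hr : 2 <= r)
    (hp : prime p) (hq : prime q) (hpq : p <> q)
    (hn : 1 < n) (hpn : gcdn p n = 1) (hqn : gcdn q n = 1)
    (m1 : presentation (smul n (prime_infty hp)))
    (m2 : presentation (prime_infty hq))
    (n1 : presentation (prime_infty hp))
    (n2 : presentation (smul n (prime_infty hq))) :
  let gamma := odo_action r m1 m2 in
  let delta := odo_action r n1 n2 in
  cont_orbit_equiv gamma delta /\ ~ conjugate_actions gamma delta.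
Proof.
split; last by apply: odo_not_conjugate => //; exact/eqP.
exact: (@odo_cont_orbit_equiv r n (Ordinal (ltnW hr)) (Ordinal hr) _ _
  m1 m2 n1 n2 erefl erefl (ltnW hn)).
Qed.
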